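(* Let $1<p<q$ be co-prime integers, and let $\ell(p,q)>1$ be the last entry of the multiplicity sequence of a cuspidal singularity with one Puiseux pair $(p,q)$. Then: (1) $m_{p,q}=pq+\ell(p,q)+1$ if $q=p+1$, or if $p>2$ and $q\equiv -1 \pmod p$; and $m_{p,q}=pq+\ell(p,q)$ in all other cases. (2) $\ell(p,q)=\left\lfloor \dfrac{q-1}{\min(u,q-u)}\right\rfloor$, where $u$ is the integer with $up\equiv 1 \pmod q$ and $1<u<q$.
   Context: For co-prime integers $1<p<q$, set $$m_{p,q}:=pq+\max\left(\left\lfloor \frac{p}{p-p'}\right\rfloor,\left\lfloor \frac{q}{q-q'}\right\rfloor\right),$$ where $p',q'$ are the integers uniquely determined by $1\le p'<p$, $1\le q'<q$ and $pq'+qp'=pq+1$. A cuspidal singularity with one Puiseux pair $(p,q)$ is a unibranch (locally irreducible) plane curve singularity of the topological type of $\{x^p=y^q\}$ at the origin. Its multiplicity sequence is the sequence of multiplicities of the singular point and of its successive proper transforms (at the unique point over the singularity) under repeated blowing up at the singular point, until the proper transform becomes smooth (the minimal resolution); only entries $>1$ are listed. Blowing up the singular point of a germ with Puiseux pair $(p,q)$ gives multiplicity $p$ and, if $q-p>1$, a germ with one Puiseux pair $(p,q-p)$ or $(q-p,p)$ (the smaller entry written first); if $q-p=1$ the proper transform is smooth. *)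

(* Defs.v *)
From HB Require Import structures.
From mathcomp Require Import all_boot all_order all_algebra.

Set Implicit Arguments.
Unset Strict Implicit.
Unset Printing Implicit Defensive.

Import GRing.Theory.
Local Open Scope ring_scope.

(* Formal power series in one variable t; x i is the coefficient of t^i. *)
Definition series (K : fieldType) : Type := nat -> K.

Definition ps_const (K : fieldType) (c : K) : series K :=
  fun i => if i == 0%N then c else 0.

Definition ps_monomial (K : fieldType) (n : nat) : series K :=
  fun i => (i == n)%:R.

Definition ps_add (K : fieldType) (x y : series K) : series K :=
  fun i => x i + y i.

Definition ps_sub (K : fieldType) (x y : series K) : series K :=
  fun i => x i - y i.

Definition ps_mul (K : fieldType) (x y : series K) : series K :=
  fun i => \sum_(j < i.+1) x j * y (i - j)%N.

Definition ps_exp (K : fieldType) (x : series K) (n : nat) : series K :=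
  iter n (ps_mul x) (ps_const 1).

Definition ps_horner (K : fieldType) (g : {poly K}) (x : series K) : series K :=
  fun i => \sum_(k < size g) g`_k * ps_exp x k i.

Definition ps_order (K : fieldType) (x : series K) (n : nat) : Prop :=
  x n != 0 /\ forall i, (i < n)%N -> x i = 0.

(* A plane branch (unibranch germ) is given by a parametrization
   t |-> (B.1 t, B.2 t) with B.1 0 = B.2 0 = 0.  Series with complex
   coefficients are formal here, which includes all convergent ones. *)
Definition branch (K : fieldType) : Type := (series K * series K)%type.

Definition centered (K : fieldType) (B : branch K) : Prop :=
  B.1 0%N = 0 /\ B.2 0%N = 0.

(* The multiplicity of a branch with a generically injective parametrization
   is the smaller of the orders of its two coordinates. *)
Definition multiplicity (K : fieldType) (B : branch K) (m : nat) : Prop :=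
  (B.1 m != 0 \/ B.2 m != 0) /\
  forall i, (i < m)%N -> B.1 i = 0 /\ B.2 i = 0.

(* B' is the proper transform of B under the blow-up of the origin, written in
   coordinates centered at its unique point on the exceptional curve.
   If ord B.1 <= ord B.2, this point lies in the chart (x, y) = (x1, x1 * y1),
   at (0, c); otherwise it is the origin of the chart (x, y) = (x1 * y1, y1). *)
Definition proper_transform (K : fieldType) (B B' : branch K) : Prop :=
  centered B' /\
  exists2 m, multiplicity B m &
    if B.1 m != 0 then
      B'.1 =1 B.1 /\
      exists c : K, B.2 =1 ps_mul B.1 (ps_add B'.2 (ps_const c))
    else
      B'.2 =1 B.2 /\ B.1 =1 ps_mul B.2 B'.1.

(* A branch is smooth exactly when its multiplicity is 1.  Sequences are
   listed from the singular point itself up to the last singular transform. *)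
Inductive multiplicity_sequence (K : fieldType) (B : branch K) :
    seq nat -> Prop :=
| MultSmooth : multiplicity B 1 -> multiplicity_sequence B [::]
| MultSingular (B' : branch K) (m : nat) (s : seq nat) :
    (1 < m)%N -> multiplicity B m -> proper_transform B B' ->
    multiplicity_sequence B' s -> multiplicity_sequence B (m :: s).

(* For coprime 1 < p < q: ord x = p and the Puiseux expansion of y in powers of
   x^(1/p) has q/p as its first non-integral exponent.  The terms with smaller
   exponents, all integral, form the polynomial g(x). *)
Definition puiseux_expansion (K : fieldType) (p q : nat) (x y : series K) :
    Prop :=
  ps_order x p /\
  exists2 g : {poly K}, g`_0 = 0 & ps_order (ps_sub y (ps_horner g x)) q.

(* Over the complex numbers, the branches with one Puiseux pair (p, q) are the
   ones of the topological type of x^p = y^q.  One of the two coordinate axes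
   is always transverse to the branch, hence the two cases. *)
Definition one_puiseux_pair (K : fieldType) (p q : nat) (B : branch K) : Prop :=
  centered B /\
  (puiseux_expansion p q B.1 B.2 \/ puiseux_expansion p q B.2 B.1).

(* m_{p,q}, for p', q' as in 1 <= p' < p, 1 <= q' < q, p q' + q p' = p q + 1;
   with these bounds the divisors are positive. *)
Definition mpq (p q p' q' : nat) : nat :=
  (p * q + maxn (p %/ (p - p')) (q %/ (q - q')))%N.

Lemma ps_mul_monomial (K : fieldType) (m n : nat) :
  ps_mul (@ps_monomial K m) (@ps_monomial K n) =1 @ps_monomial K (m + n).
Proof.
move=> i; rewrite /ps_mul /ps_monomial.
have [mi|im] := leqP m i; last first.
  rewrite big1 => [|j _].
    by rewrite (ltn_eqF (leq_trans im (leq_addr n m))).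
  by rewrite (ltn_eqF (leq_ltn_trans (ltn_ord j : (j <= i)%N) im)) mul0r.
rewrite (bigD1 (Ordinal (mi : (m < i.+1)%N))) //= eqxx mul1r.
rewrite big1 => [|j /negbTE jm]; last first.
  by rewrite -[(j : nat) == m]/(j == Ordinal (mi : (m < i.+1)%N)) jm mul0r.
by rewrite addr0 -{2}(subnKC mi) eqn_add2l.
Qed.

Lemma ps_exp_monomial (K : fieldType) (m n : nat) :
  ps_exp (@ps_monomial K m) n =1 @ps_monomial K (m * n).
Proof.
elim: n => [|n IHn] i.
  by rewrite muln0 /ps_exp /= /ps_const /ps_monomial; case: eqP.
rewrite mulnS -ps_mul_monomial /ps_exp iterS.
by apply: eq_bigr => j _; rewrite -/(ps_exp _ _) IHn.
Qed.

(* The parametrization t |-> (t^q, t^p) of the model curve x^p = y^q. *)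
Lemma model_cusp (K : fieldType) (p q : nat) : (1 < p < q)%N ->
  let B : branch K := (@ps_monomial K q, @ps_monomial K p) in
  ps_exp B.1 p =1 ps_exp B.2 q /\ one_puiseux_pair p q B.
Proof.
move=> /andP[p1 pq] B; split=> [i|]; first by rewrite !ps_exp_monomial mulnC.
have ordM n : ps_order (@ps_monomial K n) n.
  rewrite /ps_order /ps_monomial eqxx oner_neq0.
  by split=> // i lt_in; rewrite (ltn_eqF lt_in).
split.
  have p0 : (0 < p)%N by apply: ltnW.
  by rewrite /centered /= /ps_monomial (ltn_eqF p0) (ltn_eqF (ltn_trans p0 pq)).
right; split; first exact: ordM.
exists 0; first by rewrite coef0.
have [nz z] := ordM q.
rewrite /ps_order /ps_sub /ps_horner size_poly0 big_ord0 subr0; split=> // i iq.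
by rewrite big_ord0 subr0; apply: z.
Qed.

(* Main.v *)
(* One blow-up turns the Puiseux pair (p, q) into (p, q - p), up to order, so
   the multiplicity sequence follows the subtractive Euclidean algorithm and its
   last entry l is the last quotient of the continued fraction of q / p.  If
   a / b is the penultimate convergent, then a p - b q = 1 or -1, hence
   min (u, q - u) = a, and q = l a + a' with 0 < a' <= a gives (2).  Likewise
   (p - p', q - q') is (b, q - a) or (p - b, a), according to the sign, and (1)
   follows: the maximum of the two floors exceeds l only if b = b' = 1
   (q = -1 mod p) or a = a' = 1 (q = p + 1). *)
Require Import Defs.
From HB Require Import structures.
From mathcomp Require Import all_boot all_order all_algebra.
From mathcomp Require Import boolp.
From mathcomp Require Import reals.
From mathcomp Require Import complex.
From mathcomp Require Import zify ring.

Set Implicit Arguments.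
Unset Strict Implicit.
Unset Printing Implicit Defensive.

(** * Arithmetic of the last quotient and of its convergents *)

(* q / p = [c_0; ..., c_n] as a continued fraction with c_n = l > 1; a / b and
   a' / b' are its convergents of ranks n - 1 and n - 2 (1 / 0 for rank -1). *)
Definition last_quotient_spec (p q l a a' b b' : nat) : Prop :=
  [/\ q = l * a + a', p = l * b + b', 1 < l,
      [/\ 0 < a', a' <= a, b' <= b, 0 < b & b <= a]
    & a * b' = a' * b + 1 \/ a * b' + 1 = a' * b].

(** Adding 1 to a continued fraction turns each convergent [a / b] into [(a + b) / b]. *)
Lemma last_quotient_spec_subl p q l a a' b b' :
  p <= q -> last_quotient_spec p (q - p) l a a' b b' ->
  last_quotient_spec p q l (a + b) (a' + b') b b'.
Proof.
move=> pq [Eq Ep l1 [? ? ? ? ?] d]; split=> //; try lia.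
by split; lia.
Qed.

(** As [q / p = 1 + (q - p) / p], each convergent [a / b] of [p / (q - p)] becomes [1 + b / a]. *)
Lemma last_quotient_spec_subr p q l a a' b b' :
  p <= q -> last_quotient_spec (q - p) p l a a' b b' ->
  last_quotient_spec p q l (a + b) (a' + b') a a'.
Proof.
move=> pq [Eq Ep l1 [? ? ? ? ?] d]; split=> //; try lia.
by split; lia.
Qed.

Lemma last_quotient_spec_divn p q l a a' b b' :
  last_quotient_spec p q l a a' b b' ->
  (q - 1) %/ a = l /\ 2 * a < q.
Proof.
move=> [-> _ l1 [a'0 a'a _ b0 ba] _].
split; last by nia.
(* Since [0 < a' <= a], the number [a' - 1] is a remainder modulo [a], even when [a' = a]. *)
rewrite (_ : l * a + a' - 1 = l * a + (a' - 1)); last by lia.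
rewrite divnMDl; last by lia.
rewrite divn_small; lia.
Qed.

Lemma divn_leq_bound m d k : 0 < d -> m < k.+1 * d -> m %/ d <= k.
Proof. by move=> d0 h; rewrite -ltnS ltn_divLR. Qed.

Lemma divn_mulDl k d m : m < d -> (k * d + m) %/ d = k.
Proof. by move=> md; rewrite divnMDl ?divn_small ?addn0 //; lia. Qed.

(** Modulo [p] the equation determines [q * y], hence [y], because [q] is invertible there. *)
Lemma linear_comb_inj p q x y x1 y1 : coprime p q -> y < p -> y1 < p ->
  p * x + q * y = p * x1 + q * y1 -> x = x1 /\ y = y1.
Proof.
move=> cop yp y1p E.
have ly : y = y1.
  have /eqP : q * y = q * y1 %[mod p].
    by rewrite -(modnMDl x (q * y) p) -(modnMDl x1 (q * y1) p) !(mulnC _ p) E.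
  wlog le : y y1 x x1 yp y1p E / y <= y1.
    move=> W; case/orP: (leq_total y y1) => le H; first exact: (W y y1 x x1).
    by apply/esym/(W y1 y x1 x) => //; rewrite eq_sym.
  rewrite eq_sym eqn_mod_dvd; last by rewrite leq_mul2l le orbT.
  rewrite -mulnBr Gauss_dvdr // => /dvdnP[k]; case: k => [|k]; nia.
split=> //; move: E; rewrite ly => /addIn/eqP; rewrite eqn_pmul2l; last by lia.
by move/eqP.
Qed.

(** Here [x] and [y] stand for [q - q'] and [p - p']. The sign of [a * p - b * q] decides which
    floor carries [l]; the other one is at most 2. The extra unit arises when the remainder [b'] or
    [a'] equals its divisor. *)
Lemma last_quotient_spec_maxn p q l a a' b b' x y :
  last_quotient_spec p q l a a' b b' ->
  coprime p q -> 0 < y < p -> p * x + q * y + 1 = p * q ->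
  maxn (p %/ y) (q %/ x) = l + ((q == p + 1) || (2 < p) && (p %| q + 1)).
Proof.
move=> [Eq Ep l1 [a'0 a'a b'b b0 ba] d] cop /andP[y0 yp] E.
have bp : b < p by nia.
have aq : 2 * a < q by nia.
have lb : 2 * b <= l * b by rewrite leq_mul2r l1 orbT.
case: d => d.
- have Ea : a * p = b * q + 1 by nia.
  have [Ex Ey] : x = q - a /\ y = b by apply: (linear_comb_inj cop) => //; nia.
  have -> : (q == p + 1) = false.
    (* If [q = p + 1], then [b < a] yields [p <= b + 1], and [2 * b <= p] leaves only [b = 1],
       [p = 2]. *)
    apply/eqP => qp; move: Ea; rewrite qp => Ea.
    have ab : b < a.
      by have := leq_mul2r p a b; case: (leqP a b); rewrite ?orbT; lia.
    have pb : p <= b + 1 by have := leq_mul2r p b.+1 a; rewrite ab orbT; lia.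
    have [b1 p2] : b = 1 /\ p = 2 by lia.
    by move: Ea; rewrite b1 p2; lia.
  have [b'lt|b'eq] : b' < b \/ b' = b by lia.
    have -> : (2 < p) && (p %| q + 1) = false.
      apply/negbTE/negP => /andP[p2 /dvdnP[k Ek]].
      (* Putting [q + 1 = k * p] into [Ea] makes [b - 1] a multiple of [p], although [b < p]. *)
      have Eb : b - 1 = (b * k - a) * p by rewrite mulnBl -mulnA -Ek; lia.
      have b1 : b = 1 by case: (b * k - a) Eb => [|m]; rewrite ?mulSn; lia.
      have b'0 : b' = 0 by lia.
      by move: d; rewrite b'0 muln0; lia.
    rewrite Ey {1}Ep divn_mulDl //.
    have : q %/ x <= 1 by apply: divn_leq_bound; lia.
    by lia.
  rewrite b'eq in Ep d.
  (* With [b' = b] the determinant equation factors: [b = 1], so [p = l + 1] and [q + 1 = a * p]. *)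
  have /eqP : b * (a - a') = 1 by rewrite mulnBr; lia.
  rewrite muln_eq1 => /andP[/eqP b1 _]; rewrite b1 in Ep d Ea.
  have -> : (2 < p) && (p %| q + 1).
    by apply/andP; split; [lia|apply/dvdnP; exists a; lia].
  have : q %/ x <= 1 by apply: divn_leq_bound; lia.
  by rewrite Ey b1 divn1 /=; lia.
- have Ea : a * p + 1 = b * q by nia.
  have [Ex Ey] : x = a /\ y = p - b by apply: (linear_comb_inj cop); nia.
  (* The bound comes from [2 * b <= p]; as [2 <= l], this floor never exceeds [l]. *)
  have py : p %/ y <= 2 by apply: divn_leq_bound; lia.
  have [a'lt|a'eq] : a' < a \/ a' = a by lia.
    have -> : (q == p + 1) = false.
      apply/eqP => qp; move: Ea; rewrite qp => Ea.
      have Eb : b - 1 = (a - b) * p by rewrite mulnBl; lia.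
      have b1 : b = 1 by case: (a - b) Eb => [|m]; rewrite ?mulSn; lia.
      by move: Eb; rewrite b1; case a1: (a - 1) => [|m]; rewrite ?mulSn; lia.
    have -> : (2 < p) && (p %| q + 1) = false.
      apply/negbTE/negP => /andP[p2 /dvdnP[k Ek]].
      (* A positive multiple of [p] equal to [b + 1] contradicts [2 * b <= p] and [2 < p]. *)
      have Eb : b + 1 = (b * k - a) * p by rewrite mulnBl -mulnA -Ek; lia.
      by case: (b * k - a) Eb => [|m]; rewrite ?mulSn; lia.
    by rewrite Ex Eq divn_mulDl //; lia.
  rewrite a'eq in Eq d.
  (* The same factorization gives [a = b = 1] and [b' = 0], hence [p = l] and [q = l + 1]. *)
  have /eqP : a * (b - b') = 1 by rewrite mulnBr; lia.
  rewrite muln_eq1 => /andP[/eqP a1 /eqP bb']; rewrite a1 in Eq.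
  have b1 : b = 1 by lia.
  have -> : (q == p + 1) by apply/eqP; rewrite Ep b1; lia.
  by rewrite Ex a1 divn1 /=; lia.
Qed.

Lemma last_quotient_spec_mpq p q l a a' b b' p' q' u :
  last_quotient_spec p q l a a' b b' -> coprime p q ->
  1 <= p' < p -> 1 <= q' < q -> p * q' + q * p' = p * q + 1 ->
  1 < u < q -> u * p = 1 %[mod q] ->
  maxn (p %/ (p - p')) (q %/ (q - q')) =
    l + ((q == p + 1) || (2 < p) && (p %| q + 1)) /\
  l = (q - 1) %/ minn u (q - u).
Proof.
move=> S cop hp' hq' E /andP[u1 uq] up; split.
  apply: (last_quotient_spec_maxn S cop); first by lia.
  by rewrite !mulnBr; have := leq_mul2l p q' q; have := leq_mul2l q p' p; lia.
have [<- aq] := last_quotient_spec_divn S; congr (_ %/ _).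
have [Eq Ep l1 [a'0 a'a b'b b0 ba] d] := S.
have bp : b < p by rewrite Ep; have := leq_mul2r b 2 l; lia.
have cop' : coprime q p by rewrite coprime_sym.
have Ec : p * u = q * ((u * p) %/ q) + 1.
  by rewrite mulnC [LHS](divn_eq (u * p) q) up modn_small ?(mulnC q) //; lia.
(* The solution of [Ec] is [(b, a)] or [(p - b, q - a)], by sign; in both cases [2 * a < q] makes
   [a] the minimum of [u] and [q - u]. *)
have [] : a * p = b * q + 1 \/ a * p + 1 = b * q.
  by clear - Eq Ep d; case: d => d; [left|right]; rewrite Eq Ep; lia.
- move=> Ea.
  have [_ <-] : (u * p) %/ q = b /\ a = u.
    by clear -cop' Ec Ea uq aq; apply: (linear_comb_inj cop'); lia.
  by clear -aq; lia.
- move=> Ea.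
  have [_ <-] : (u * p) %/ q = p - b /\ q - a = u.
    have := leq_mul2l q b p; have := leq_mul2l p a q.
    clear -cop' Ec Ea uq aq bp b0 a'0 a'a => le_a le_b.
    by apply: (linear_comb_inj cop'); rewrite ?mulnBr; lia.
  by clear -aq; lia.
Qed.

(** * The commutative ring of formal power series *)

Import GRing.Theory.
Local Open Scope ring_scope.

Definition ps_trunc (K : fieldType) (n : nat) (x : series K) : {poly K} :=
  \poly_(i < n) x i.

(** A coefficient of a product involves only coefficients of at most the same rank, so truncations
    suffice, and commutativity and associativity are inherited from [{poly K}]. *)
Lemma coef_ps_mul (K : fieldType) (n i : nat) (x y : series K)
    (p q : {poly K}) :
  (i < n)%N -> (forall j, (j < n)%N -> p`_j = x j) ->
  (forall j, (j < n)%N -> q`_j = y j) -> ps_mul x y i = (p * q)`_i.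
Proof.
move=> ltin Ep Eq; rewrite coefM; apply: eq_bigr => j _.
by rewrite Ep ?Eq //; have := ltn_ord j; lia.
Qed.

Lemma coef_ps_trunc (K : fieldType) (n : nat) (x : series K) (j : nat) :
  (j < n)%N -> (ps_trunc n x)`_j = x j.
Proof. by move=> ltjn; rewrite coef_poly ltjn. Qed.

Lemma ps_mulC (K : fieldType) : commutative (@ps_mul K).
Proof.
move=> x y; apply/funext => i.
rewrite (coef_ps_mul (ltnSn i) (@coef_ps_trunc _ _ x) (@coef_ps_trunc _ _ y)).
rewrite mulrC; apply/esym/(@coef_ps_mul _ i.+1) => // j; exact: coef_ps_trunc.
Qed.

Lemma ps_mulA (K : fieldType) : associative (@ps_mul K).
Proof.
move=> x y z; apply/funext => i.
have tr := @coef_ps_trunc K i.+1.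
rewrite (coef_ps_mul (ltnSn i) (tr x) (q := ps_trunc i.+1 y * ps_trunc i.+1 z)).
- rewrite mulrA; apply/esym/(coef_ps_mul (ltnSn i) _ (tr z)) => j ltj.
  by apply/esym/(coef_ps_mul ltj); apply: tr.
- by move=> j ltj; apply/esym/(coef_ps_mul ltj); apply: tr.
Qed.

Lemma ps_mul1 (K : fieldType) : left_id (ps_const 1) (@ps_mul K).
Proof.
move=> x; apply/funext => i; rewrite /ps_mul big_ord_recl /= subn0 mul1r.
by rewrite big1 ?addr0 // => j _; rewrite mul0r.
Qed.

Lemma ps_mulDl (K : fieldType) : left_distributive (@ps_mul K) (@ps_add K).
Proof.
move=> x y z; apply/funext => i; rewrite /ps_mul /ps_add -big_split.
by apply: eq_bigr => j _; rewrite mulrDl.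
Qed.

Lemma ps_addA (K : fieldType) : associative (@ps_add K).
Proof. by move=> x y z; apply/funext => i; rewrite /ps_add addrA. Qed.

Lemma ps_addC (K : fieldType) : commutative (@ps_add K).
Proof. by move=> x y; apply/funext => i; rewrite /ps_add addrC. Qed.

Lemma ps_add0 (K : fieldType) : left_id (fun=> 0) (@ps_add K).
Proof. by move=> x; apply/funext => i; rewrite /ps_add add0r. Qed.

Lemma ps_addN (K : fieldType) :
  left_inverse (fun=> 0) (fun (x : series K) i => - x i) (@ps_add K).
Proof. by move=> x; apply/funext => i; rewrite /ps_add addNr. Qed.

Section SeriesRing.
Variable K : fieldType.

HB.instance Definition _ := gen_eqMixin (series K).
HB.instance Definition _ := gen_choiceMixin (series K).
HB.instance Definition _ :=
  GRing.isZmodule.Build (series K)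
    (@ps_addA K) (@ps_addC K) (@ps_add0 K) (@ps_addN K).

Fact ps_one_neq0 : ps_const 1 != 0 :> series K.
Proof.
by apply/eqP => /(congr1 (@^~ 0%N)) /eqP; rewrite /ps_const /= oner_eq0.
Qed.

HB.instance Definition _ :=
  GRing.Zmodule_isComNzRing.Build (series K)
    (@ps_mulA K) (@ps_mulC K) (@ps_mul1 K) (@ps_mulDl K) ps_one_neq0.

Fact ps_const_is_zmod_morphism : zmod_morphism (@ps_const K).
Proof.
move=> a b; apply/funext => i; rewrite /ps_const.
change ((if i == 0%N then a - b else 0) =
  (if i == 0%N then a else 0) - (if i == 0%N then b else 0)).
by case: eqP; rewrite ?subr0.
Qed.

Lemma ps_const_mul (a : K) (x : series K) :
  (ps_const a * x : series K) = (fun i => a * x i).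
Proof.
apply/funext => i.
rewrite -[LHS]/(ps_mul _ _ i) /ps_mul big_ord_recl /= subn0.
by rewrite big1 ?addr0 // => j _; rewrite mul0r.
Qed.

Fact ps_const_is_monoid_morphism : monoid_morphism (@ps_const K).
Proof.
split=> // a b; rewrite ps_const_mul; apply/funext => i.
by rewrite /ps_const; case: eqP; rewrite ?mulr0.
Qed.

HB.instance Definition _ :=
  GRing.isZmodMorphism.Build K (series K) (@ps_const K)
    ps_const_is_zmod_morphism.
HB.instance Definition _ :=
  GRing.isMonoidMorphism.Build K (series K) (@ps_const K)
    ps_const_is_monoid_morphism.

(** * Order, inverses and evaluation of polynomials at series *)

Implicit Types (x y z : series K) (g h : {poly K}).

Lemma ps_expE x n : ps_exp x n = x ^+ n.
Proof. by elim: n => [|n IHn] //; rewrite exprS -IHn. Qed.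

Lemma ps_coefD x y i : (x + y) i = x i + y i. Proof. by []. Qed.

Lemma ps_coefN x i : (- x) i = - x i. Proof. by []. Qed.

Lemma ps_coef_sum (I : Type) (r : seq I) (P : pred I) (F : I -> series K) i :
  (\sum_(k <- r | P k) F k) i = \sum_(k <- r | P k) F k i.
Proof. exact: (big_morph (fun x : series K => x i)). Qed.

Lemma ps_coefM0 x y : (x * y) 0%N = x 0%N * y 0%N.
Proof. by rewrite -[LHS]/(ps_mul _ _ _) /ps_mul big_ord1. Qed.

(** This is [ps_horner] recast as evaluation in the ring of series, where the algebra of [horner]
    applies. *)
Definition ps_eval g x : series K := (map_poly (@ps_const K) g).[x].

Lemma ps_hornerE g x : ps_horner g x = ps_eval g x.
Proof.
apply/funext => i; rewrite /ps_eval horner_coef.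
rewrite size_map_inj_poly ?rmorph0 //; last first.
  by move=> a b /(congr1 (@^~ 0%N)).
rewrite ps_coef_sum; apply: eq_bigr => k _.
by rewrite coef_map ps_expE ps_const_mul.
Qed.

Notation t_ n := (@ps_monomial K n : series K).

Lemma monomialM m n : t_ m * t_ n = t_ (m + n).
Proof. by apply/funext/ps_mul_monomial. Qed.

Lemma monomial_coefM n x i :
  (t_ n * x) i = if (i < n)%N then 0 else x (i - n)%N.
Proof.
rewrite -[LHS]/(ps_mul _ _ _) /ps_mul /ps_monomial.
case: ltnP => [ltin|lenin].
  rewrite big1 // => j _.
  by rewrite (ltn_eqF (leq_ltn_trans (ltn_ord j : (j <= i)%N) ltin)) mul0r.
rewrite (bigD1 (Ordinal (lenin : (n < i.+1)%N))) //= eqxx mul1r.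
rewrite big1 ?addr0 // => j.
by rewrite -val_eqE /= => /negbTE->; rewrite mul0r.
Qed.

Lemma monomial_dvd n x :
  (forall i, (i < n)%N -> x i = 0) -> exists z, x = t_ n * z.
Proof.
move=> x0; exists (fun i => x (n + i)%N); apply/funext => i.
by rewrite monomial_coefM; case: ltnP => [/x0//|/subnKC->].
Qed.

Lemma ps_orderP x n :
  ps_order x n <-> exists2 z : series K, x = t_ n * z & z 0%N != 0.
Proof.
split=> [[xn /monomial_dvd[z E]]|[z -> z0]].
  by exists z => //; move: xn; rewrite E monomial_coefM ltnn subnn.
split=> [|i ltin]; rewrite monomial_coefM ?ltnn ?subnn //.
by rewrite ltin.
Qed.

(** The first [n] coefficients of the inverse of [z], each solved from the equation for the
    coefficient of the same rank in the product. *)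
Fixpoint ps_inv_seq z (n : nat) : seq K :=
  if n is m.+1 then
    let s := ps_inv_seq z m in
    rcons s (((m == 0%N)%:R - \sum_(j < m) z (m - j)%N * s`_j) / z 0%N)
  else [::].

Lemma size_ps_inv_seq z n : size (ps_inv_seq z n) = n.
Proof. by elim: n => //= n IHn; rewrite size_rcons IHn. Qed.

Lemma nth_ps_inv_seq z n i : (i < n)%N ->
  (ps_inv_seq z n)`_i = (ps_inv_seq z i.+1)`_i.
Proof.
elim: n => // n IHn; rewrite ltnS leq_eqVlt => /orP[/eqP->//|ltin].
by rewrite /= nth_rcons size_ps_inv_seq ltin IHn.
Qed.

Lemma ps_unit z : z 0%N != 0 -> exists w : series K, w * z = 1.
Proof.
move=> z0; exists (fun i => (ps_inv_seq z i.+1)`_i); apply/funext => i.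
rewrite -[LHS]/(ps_mul _ _ i) /ps_mul big_ord_recr /= subnn.
rewrite nth_rcons size_ps_inv_seq ltnn eqxx divfK //.
rewrite (eq_bigr (fun j : 'I_i => z (i - j)%N * (ps_inv_seq z i)`_j)).
  by rewrite addrC subrK -[RHS]/(if i == 0%N then 1 else 0); case: eqP.
move=> j _; rewrite mulrC; congr (_ * _).
exact/esym/nth_ps_inv_seq.
Qed.

(** The power of [t] is removed by a shift of coefficients, and the remaining factor is a unit. *)
Lemma ps_order_lreg x n : ps_order x n -> GRing.lreg x.
Proof.
move=> /ps_orderP[z -> z0] a b; rewrite -!mulrA => E.
have {E} E : z * a = z * b.
  apply/funext => i; move/(congr1 (@^~ (n + i)%N)): E.
  by rewrite !monomial_coefM ltnNge leq_addr addKn.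
have [w wz] := ps_unit z0.
by rewrite -[a]mul1r -wz -mulrA E mulrA wz mul1r.
Qed.

Lemma ps_evalD g h x : ps_eval (g + h) x = ps_eval g x + ps_eval h x.
Proof. by rewrite /ps_eval rmorphD hornerD. Qed.

Lemma ps_evalC c x : ps_eval c%:P x = ps_const c.
Proof. by rewrite /ps_eval map_polyC hornerC. Qed.

Lemma ps_evalMX g x : ps_eval (g * 'X) x = ps_eval g x * x.
Proof. by rewrite /ps_eval rmorphM /= map_polyX hornerMX. Qed.

Lemma ps_evalM g h x : ps_eval (g * h) x = ps_eval g x * ps_eval h x.
Proof. by rewrite /ps_eval rmorphM hornerM. Qed.

Lemma ps_evalX x : ps_eval 'X x = x.
Proof. by rewrite /ps_eval map_polyX hornerX. Qed.

Lemma ps_eval_Xn n x : ps_eval 'X^n x = x ^+ n.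
Proof. by rewrite /ps_eval map_polyXn hornerXn. Qed.

Lemma ps_eval_comp g h x : ps_eval (g \Po h) x = ps_eval g (ps_eval h x).
Proof. by rewrite /ps_eval map_comp_poly horner_comp. Qed.

Lemma poly_mulX_coef0 g : exists g1, g = g1 * 'X + (g`_0)%:P.
Proof.
exists (drop_poly 1 g); rewrite -{1}(poly_take_drop 1 g) addrC; congr (_ + _).
by apply/polyP => i; rewrite coef_take_poly coefC; case: i.
Qed.

Lemma ps_eval_coef0 g x : x 0%N = 0 -> ps_eval g x 0%N = g`_0.
Proof.
move=> x0; have [g1 ->] := poly_mulX_coef0 g.
rewrite ps_evalD ps_evalMX ps_evalC coefD coefMX coefC /= add0r.
by rewrite ps_coefD ps_coefM0 x0 mulr0 add0r.
Qed.

(** [s] is the divided difference of [g]; its constant term is the derivative of [g] at 0, since [x]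
    and [y] vanish there. *)
Lemma ps_eval_sub g x y : x 0%N = 0 -> y 0%N = 0 ->
  exists2 s : series K, ps_eval g x - ps_eval g y = s * (x - y)
    & s 0%N = g`_1.
Proof.
move=> x0 y0; elim/poly_ind: g => [|g c [s Es s0]].
  by exists 0; rewrite ?coef0 // mul0r !ps_evalC subrr.
exists (s * x + ps_eval g y).
  rewrite !ps_evalD !ps_evalMX !ps_evalC.
  have -> : ps_eval g x = s * (x - y) + ps_eval g y by rewrite -Es subrK.
  ring.
rewrite ps_coefD ps_coefM0 x0 mulr0 add0r ps_eval_coef0 //.
by rewrite coefD coefMX coefC addr0.
Qed.

(** Compositional inverse of [g] up to a prescribed precision, corrected by one coefficient at each
    step of the induction. *)
Lemma poly_inverse_mod g N : g`_0 = 0 -> g`_1 != 0 ->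
  exists h, exists w, [/\ h`_0 = 0, h`_1 != 0 & h \Po g = 'X + w * 'X^(N.+2)].
Proof.
have [G] := poly_mulX_coef0 g => + g0; rewrite g0 addr0 => Eg.
rewrite {1}Eg coefMX /= => G0.
elim: N => [|N [h [w [h0 h1 E]]]].
  have [G1 EG] := poly_mulX_coef0 G.
  exists ((G`_0)^-1 *: 'X), ((G`_0)^-1 *: G1); split.
  - by rewrite coefZ coefX mulr0.
  - by rewrite coefZ coefX mulr1 invr_eq0.
  have EGX : G * 'X = G`_0 *: 'X + G1 * 'X^2.
    by rewrite [in LHS]EG mulrDl mul_polyC -mulrA -expr2 addrC.
  rewrite comp_polyZ comp_polyX Eg EGX scalerDr scalerA mulVf // scale1r.
  by rewrite scalerAl.
(* As [g = G * 'X], subtracting [a] times the power [N.+2] of [g] cancels exactly the constant term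
   of [w]. *)
pose a := w`_0 / G`_0 ^+ N.+2.
have [w1 Ew] := poly_mulX_coef0 (w - a *: G ^+ N.+2).
exists (h - a *: 'X^(N.+2)), w1; split.
- by rewrite coefB h0 coefZ coefXn mulr0 subrr.
- by rewrite coefB coefZ coefXn mulr0 subr0.
rewrite comp_polyB E comp_polyZ comp_Xn_poly {1}Eg exprMn.
have -> : w1 * 'X^(N.+3) = w1 * 'X * 'X^(N.+2) by rewrite exprS mulrA.
have -> : w1 * 'X = w - a *: G ^+ N.+2.
  rewrite Ew [X in X%:P](_ : _ = 0) ?addr0 //.
  rewrite coefB coefZ -!horner_coef0 horner_exp !horner_coef0 /a.
  by rewrite divfK ?subrr // expf_neq0.
by rewrite mulrBl -scalerAl addrA.
Qed.

(** * Puiseux expansions under one blow-up *)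

Lemma ps_lowM n x y : (forall i, (i < n)%N -> x i = 0) ->
  (forall i, (i < n)%N -> (x * y) i = 0) /\ (x * y) n = x n * y 0%N.
Proof.
move=> /monomial_dvd[z ->]; rewrite -mulrA; split=> [i ltin|].
  by rewrite monomial_coefM ltin.
by rewrite !monomial_coefM !ltnn !subnn ps_coefM0.
Qed.

Lemma ps_orderM n x y : ps_order x n -> y 0%N != 0 -> ps_order (x * y) n.
Proof.
by move=> [xn x0] y0; have [? E] := ps_lowM y x0; split; rewrite // E mulf_neq0.
Qed.

Lemma ps_exp_low n x : x 0%N = 0 -> forall i, (i < n)%N -> (x ^+ n) i = 0.
Proof.
move=> x0; have /monomial_dvd[z ->] : forall i, (i < 1)%N -> x i = 0 by case.
rewrite exprMn => i ltin.
by rewrite -ps_expE (_ : ps_exp _ n = t_ n) ?monomial_coefM ?ltin //;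
  apply/funext => j; rewrite ps_exp_monomial mul1n.
Qed.

(** Dividing [y = x G(x) + t^q r] by [x = t^p z] leaves [G(x)] plus a term of order [q - p]; the
    constant of [G] becomes [c]. The new exponent [q - p] may be below [p], which [puiseux_swap]
    repairs. *)
Lemma puiseux_divide p q x y : (0 < p < q)%N -> puiseux_expansion p q x y ->
  exists c, exists y' : series K,
  [/\ y = x * (y' + ps_const c), y' 0%N = 0 & puiseux_expansion p (q - p) x y'].
Proof.
move=> /andP[p0 pq] [ordx [g g0]]; rewrite ps_hornerE.
move=> /ps_orderP[r]; rewrite -[ps_sub _ _]/(y - ps_eval g x : series K).
move=> /eqP; rewrite subr_eq => /eqP Ey r0.
have [z Ex z0] := (ps_orderP x p).1 ordx.
have [w wz] := ps_unit z0.
have x0 : x 0%N = 0 by apply: ordx.2.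
have [G] := poly_mulX_coef0 g; rewrite g0 addr0 => Eg.
have wr0 : (r * w) 0%N != 0.
  rewrite ps_coefM0 mulf_neq0 //; apply: contra_neq (oner_neq0 K) => w0.
  by have := congr1 (@^~ 0%N) wz; rewrite /= ps_coefM0 w0 mul0r => /esym.
pose e : series K := t_ (q - p) * (r * w).
exists G`_0, (ps_eval (G - (G`_0)%:P) x + e); split.
- rewrite Ey Eg ps_evalMX ps_evalD -polyCN ps_evalC rmorphN /=.
  rewrite -(subnKC (ltnW pq)) -monomialM /e -[t_ p * _ * r]mulr1 -wz {4}Ex.
  by rewrite Ex; ring.
- rewrite ps_coefD ps_eval_coef0 // coefB coefC subrr add0r.
  by rewrite /e monomial_coefM subn_gt0 pq.
- split=> //; exists (G - (G`_0)%:P); first by rewrite coefB coefC subrr.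
  rewrite ps_hornerE; apply/ps_orderP; exists (r * w) => //.
  by rewrite -[LHS]/(_ - _ : series K) addrC addKr.
Qed.

Lemma puiseux_low p q x y : (0 < p < q)%N -> puiseux_expansion p q x y ->
  forall i, (i < p)%N -> y i = 0.
Proof.
move=> pq E; have [c [y' [-> _ _]]] := puiseux_divide pq E.
by have [] := ps_lowM (y' + ps_const c) E.1.2.
Qed.

(* Inverting g up to order q in y = g(x) + ... gives the expansion of x in y;
   needed when both coordinates have order p, as the blow-up chart is then
   imposed by the first one. *)
Lemma puiseux_invert p q x y : (0 < p < q)%N -> puiseux_expansion p q x y ->
  y p != 0 -> puiseux_expansion p q y x.
Proof.
move=> pq Exy yp; have ylow := puiseux_low pq Exy.
have [ordx [g g0]] := Exy; rewrite ps_hornerE => ordr.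
case/andP: pq => p0 pq.
have x0 : x 0%N = 0 by apply: ordx.2.
have y0 : y 0%N = 0 by apply: ylow.
have [G] := poly_mulX_coef0 g; rewrite g0 addr0 => Eg.
(* Since [p < q], the coefficient of [t^p] in [y] is the linear coefficient of [g] times that of
   [x]. *)
have g1 : g`_1 != 0.
  rewrite Eg coefMX /=; apply: contra_neq yp => G0.
  have := ordr.2 p pq; rewrite /ps_sub Eg ps_evalMX mulrC.
  have [_ ->] := ps_lowM (ps_eval G x) ordx.2.
  by rewrite ps_eval_coef0 // G0 mulr0 subr0.
(* Precision [q.+2] pushes the error of the inversion beyond order [q]. *)
have [h [w [h0 h1 E]]] := poly_inverse_mod q g0 g1.
split=> //; exists h => //.
have gx0 : ps_eval g x 0%N = 0 by rewrite ps_eval_coef0.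
have [s Es s0] := ps_eval_sub h y0 gx0.
(* [x - h(y)] is split as [(h(g(x)) - h(y)) + (x - h(g(x)))]; the divided difference gives the first
   part order [q]. *)
have Eh : ps_sub x (ps_horner h y) =
    (y - ps_eval g x) * (- s) + x ^+ q.+2 * - ps_eval w x.
  rewrite ps_hornerE -[LHS]/(x - ps_eval h y).
  rewrite -[ps_eval h y](subrK (ps_eval h (ps_eval g x))) Es -ps_eval_comp E.
  by rewrite ps_evalD ps_evalX ps_evalM ps_eval_Xn; ring.
have ordrs : ps_order ((y - ps_eval g x) * (- s)) q.
  by apply: ps_orderM; rewrite // ps_coefN oppr_eq0 s0.
have [low _] := ps_lowM (- ps_eval w x) (@ps_exp_low q.+2 x x0).
rewrite Eh; split=> [|i ltiq]; rewrite ps_coefD low ?addr0; try lia.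
  exact: ordrs.1.
exact: ordrs.2.
Qed.

(** As [g(x)] vanishes below order [p > q], the order of [y] is [q]; [x] has order [p] itself, so
    the zero polynomial serves for its expansion in [y]. *)
Lemma puiseux_swap p q x y : (0 < q < p)%N -> puiseux_expansion p q x y ->
  puiseux_expansion q p y x.
Proof.
move=> /andP[q0 qp] [ordx [g g0]]; rewrite ps_hornerE => ordr.
have [G] := poly_mulX_coef0 g; rewrite g0 addr0 => Eg.
have [low _] := ps_lowM (ps_eval G x) ordx.2.
split; last first.
  exists 0; rewrite ?coef0 // ps_hornerE -[ps_sub _ _]/(_ - _ : series K).
  by rewrite (_ : ps_eval 0 y = 0) ?subr0 // ps_evalC rmorph0.
move: ordr; rewrite Eg ps_evalMX mulrC /ps_order /ps_sub low // subr0.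
move=> [yq ylow]; split=> // i ltiq.
by rewrite -(ylow i ltiq) low ?subr0 //; lia.
Qed.

Lemma one_puiseux_pair_swap p q (B : branch K) : (0 < q < p)%N ->
  one_puiseux_pair p q B -> one_puiseux_pair q p B.
Proof.
by move=> qp [cB [E|E]]; split=> //; [right|left]; apply: puiseux_swap E.
Qed.

Lemma one_puiseux_pair_multiplicity p q (B : branch K) : (0 < p < q)%N ->
  one_puiseux_pair p q B -> multiplicity B p.
Proof.
move=> pq [_ [] E]; have low := puiseux_low pq E; have [xp xlow] := E.1; split.
- by left.
- by move=> i ltip; rewrite low ?xlow.
- by right.
- by move=> i ltip; rewrite low ?xlow.
Qed.

Lemma blow_up p q (B : branch K) : (0 < p < q)%N -> one_puiseux_pair p q B ->
  exists2 B', proper_transform B B' & one_puiseux_pair p (q - p) B'.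
Proof.
move=> pq oB; have mB := one_puiseux_pair_multiplicity pq oB.
have [[B10 B20] E] := oB; have [B1p|B1p] := eqVneq (B.1 p) 0.
  have {}E : puiseux_expansion p q B.2 B.1.
    by case: E => // -[[]]; rewrite B1p eqxx.
  have [c [y [Ey y0 E']]] := puiseux_divide pq E.
  (* The coefficient of [t^p] in [B.1] is zero, so the point is the origin of the second chart. *)
  have c0 : c = 0.
    have := ps_lowM (y + ps_const c) E.1.2; rewrite -Ey B1p => -[_ /esym/eqP].
    rewrite mulf_eq0 (negbTE E.1.1) ps_coefD y0 add0r => /eqP; exact.
  exists (y, B.2); last by split=> //; right.
  split=> //; exists p; rewrite // B1p eqxx /=; split=> // i.
  by rewrite Ey c0 rmorph0 addr0.
have {}E : puiseux_expansion p q B.1 B.2.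
  by case: E => // E; apply: puiseux_invert E B1p.
have [c [y [Ey y0 E']]] := puiseux_divide pq E.
exists (B.1, y); last by split=> //; left.
split=> //; exists p; rewrite // B1p; split=> //; exists c => i.
by rewrite {1}Ey.
Qed.

(** * Uniqueness of the multiplicity sequence *)

Lemma multiplicity_inj (B : branch K) m n :
  multiplicity B m -> multiplicity B n -> m = n.
Proof.
move=> [Bm lm] [Bn ln]; case: (ltngtP m n) => // [/ln[E1 E2]|/lm[E1 E2]].
  by case: Bm; rewrite ?E1 ?E2 eqxx.
by case: Bn; rewrite ?E1 ?E2 eqxx.
Qed.

(** The dividing coordinate has an order, so it cancels; in the first chart, centering then
    separates the constant from the new coordinate. *)
Lemma proper_transform_inj (B B1 B2 : branch K) :
  proper_transform B B1 -> proper_transform B B2 -> B1 = B2.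
Proof.
move=> [[_ c1] [m mB +]] [[_ c2] [n nB +]].
rewrite -(multiplicity_inj mB nB) {nB n}.
case: ifP => [Bm|/eqP Bm].
  have ordB : ps_order B.1 m by split=> // i /mB.2[].
  move=> [/funext E1 [a Ea]] [/funext E2 [b Eb]].
  have {Ea Eb} /(ps_order_lreg ordB) E :
      B.1 * (B1.2 + ps_const a) = B.1 * (B2.2 + ps_const b).
    by apply/funext => i; rewrite -[LHS]Ea Eb.
  have ab : a = b.
    by move/(congr1 (@^~ 0%N)): E; rewrite !ps_coefD c1 c2 !add0r.
  move: E; rewrite ab => /addIr E.
  by case: B1 B2 E1 E2 E {c1 c2} => [? ?] [? ?] /= -> -> ->.
have ordB : ps_order B.2 m.
  by split=> [|i /mB.2[]//]; case: mB.1; rewrite ?Bm ?eqxx.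
move=> [/funext E1 Ea] [/funext E2 Eb].
have /(ps_order_lreg ordB) E : B.2 * B1.1 = B.2 * B2.1.
  by apply/funext => i; rewrite -[LHS]Ea Eb.
by case: B1 B2 E1 E2 E {c1 c2 Ea Eb} => [? ?] [? ?] /= -> -> ->.
Qed.

Lemma multiplicity_sequence_inj (B : branch K) s s' :
  multiplicity_sequence B s -> multiplicity_sequence B s' -> s = s'.
Proof.
move=> H; elim: H s' => {B s} [B m1|B B' m s m1 mB pB _ IH] s' H.
  by case: H => // B' m s m_gt1 mB; rewrite (multiplicity_inj mB m1) in m_gt1.
case: H => [sB|B1 n {}s' _ nB pB1 H].
  by rewrite (multiplicity_inj mB sB) in m1.
rewrite (proper_transform_inj pB1 pB) in H.
by rewrite (multiplicity_inj mB nB) (IH _ H).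
Qed.

End SeriesRing.

(** * The multiplicity sequence as a Euclidean algorithm, and the conclusion *)

Local Open Scope nat_scope.

(** Strong induction on [q]: each blow-up is one subtraction, and the convergents are carried along
    with the last entry. *)
Lemma one_puiseux_pair_sequence (K : fieldType) (p q : nat) (B : branch K) :
  1 < p < q -> coprime p q -> one_puiseux_pair p q B ->
  exists s, multiplicity_sequence B s /\
    exists a a' b b', last_quotient_spec p q (last 0 s) a a' b b'.
Proof.
have [n] := ubnP q; elim: n => // n IHn in p q B *; rewrite ltnS => leqn.
move=> /andP[p1 pq] cop oB; have p0 := ltnW p1.
have [|B' tB oB'] := blow_up _ oB; first by rewrite p0.
have mB : multiplicity B p.
  by apply: (one_puiseux_pair_multiplicity _ oB); rewrite p0.
have copB : coprime p (q - p).
  by rewrite /coprime -(gcdnDl p (q - p)) subnKC 1?ltnW.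
(* [1 < l] excludes the empty [s], whose last entry defaults to 0, so prepending [p] keeps the last
   entry. *)
have consP s l a a' b b' : 1 < l -> multiplicity_sequence B' s ->
    last 0 s = l -> last_quotient_spec p q l a a' b b' ->
    exists s, multiplicity_sequence B s /\
    exists a a' b b', last_quotient_spec p q (last 0 s) a a' b b'.
  move=> l1 ms ls S; exists (p :: s); split; first exact: MultSingular tB ms.
  by exists a, a', b, b'; case: s ls {ms} => [|? ?] /= E; [lia|rewrite E].
have [d1|d1] := leqP (q - p) 1.
  have d1' : q - p = 1 by lia.
  exists [:: p]; split.
    (* The transform has the pair [(p, 1)], that is [(1, p)] after the swap, hence multiplicity
       1. *)
    apply: MultSingular tB _ => //; apply: MultSmooth.
    rewrite d1' in oB'; apply: (@one_puiseux_pair_multiplicity K 1 p) => //.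
    exact: one_puiseux_pair_swap oB'.
  (* Here [q / p = [1; p]], with convergents [1 / 1] and [1 / 0]. *)
  by exists 1, 1, 1, 0; split=> //=; [lia|lia|right].
have [qp|qp|qp] := ltngtP p (q - p).
- have [||s [ms [a [a' [b [b' S]]]]]] :=
    IHn p (q - p) B' _ _ copB oB'; [lia|lia|].
  have l1 : 1 < last 0 s by case: S.
  apply: (consP s _ (a + b) (a' + b') b b' l1 ms erefl).
  exact: last_quotient_spec_subl (ltnW pq) S.
- have {}oB' : one_puiseux_pair (q - p) p B'.
    by apply: one_puiseux_pair_swap oB'; lia.
  rewrite coprime_sym in copB.
  have [||s [ms [a [a' [b [b' S]]]]]] :=
    IHn (q - p) p B' _ _ copB oB'; [lia|lia|].
  have l1 : 1 < last 0 s by case: S.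
  apply: (consP s _ (a + b) (a' + b') a a' l1 ms erefl).
  exact: last_quotient_spec_subr (ltnW pq) S.
- by move: copB; rewrite -qp /coprime gcdnn; lia.
Qed.

Theorem theorem1p1 (R : realType) (p q p' q' u : nat)
    (hp : 1 < p) (hpq : p < q) (hcop : coprime p q)
    (hp' : 1 <= p' < p) (hq' : 1 <= q' < q)
    (hpq' : p * q' + q * p' = p * q + 1)
    (hu : 1 < u < q) (hup : u * p = 1 %[mod q])
    (B : branch (complex R)) (hB : one_puiseux_pair p q B) :
  exists s : seq nat,
    unique (multiplicity_sequence B) s /\
    let l := last 0 s in
    [/\ 1 < l,
        q = p + 1 \/ (2 < p /\ p %| q + 1) -> mpq p q p' q' = p * q + l + 1,
        ~ (q = p + 1 \/ (2 < p /\ p %| q + 1)) -> mpq p q p' q' = p * q + l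
      & l = (q - 1) %/ minn u (q - u)].
Proof.
have [|s [ms [a [a' [b [b' S]]]]]] := one_puiseux_pair_sequence _ hcop hB.
  by rewrite hp.
exists s; split; first by split=> // s'; apply: multiplicity_sequence_inj.
have [Emax El] := last_quotient_spec_mpq S hcop hp' hq' hpq' hu hup.
rewrite /mpq Emax addnA /=; split=> //; first by case: S.
- by case=> [->|[-> ->]]; rewrite ?eqxx ?orbT.
- move=> nc; rewrite [X in nat_of_bool X](_ : _ = false) ?addn0 //.
  apply/negbTE/negP => /orP[/eqP ?|/andP[? ?]]; apply: nc; by [left|right].
Qed.
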